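(* Let $G$ be a finite group with $|G|=n\geqslant 2$, let $S\subseteq G$ be a symmetric generating set with $|S|=d\geqslant 1$, and suppose that the Cayley graph $C(G,S)$ is an expander, i.e. its vertex Cheeger constant $h(G)$ is positive. If $C(G,S)$ is non-bipartite, then the largest eigenvalue $\lambda_n$ of the normalised Laplacian matrix of $C(G,S)$ satisfies $$\lambda_{n}\leqslant 2 - \frac{h(G)^{4}}{\alpha\, d^{6}(d+1)^{2}},$$ where $\alpha$ is an absolute constant; one can take $\alpha = 2^{9}$.
   Context: A subset $S\subseteq G$ is symmetric if $S=S^{-1}$. The Cayley graph $C(G,S)$ has vertex set $G$, with an edge between $x$ and $y$ if and only if $sx=y$ for some $s\in S$; if $1\in S$ then every vertex carries a loop, which is treated as an edge (counted once in the degree). Thus $C(G,S)$ is $d$-regular. The graph is bipartite if its vertex set can be partitioned into two sets such that every edge joins the two sets (so a graph with a loop is non-bipartite). The normalised adjacency matrix $T$ is the $n\times n$ matrix with $T_{x,y}=\frac1d$ if $yx^{-1}\in S$ and $0$ otherwise. The normalised Laplacian matrix is $L=I_n-T$; its eigenvalues, which lie in $[0,2]$, are written $0=\lambda_1\leqslant\lambda_2\leqslant\dots\leqslant\lambda_n\leqslant 2$. For a graph $(V,E)$ and $V_1\subseteq V$, let $N(V_1)=\{v\in V: vv_1\in E\text{ for some }v_1\in V_1\}$ and $\delta(V_1)=N(V_1)\setminus V_1$. The (vertex) Cheeger constant is $\inf\{|\delta(V_1)|/|V_1| : \emptyset\neq V_1\subseteq V,\ |V_1|\leqslant |V|/2\}$;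 $h(G)$ denotes this constant for the graph $C(G,S)$. For $C(G,S)$ one has $\delta(V_1)=SV_1\setminus V_1$, where $SV_1=\{sv: s\in S, v\in V_1\}$. *)

(* Defs.v *)
From mathcomp Require Import all_boot all_order all_algebra all_fingroup.
From mathcomp Require Import all_classical all_reals.
From mathcomp Require Import polyrcf.

Set Implicit Arguments.
Unset Strict Implicit.
Unset Printing Implicit Defensive.

Import Order.TTheory GRing.Theory Num.Theory.

Local Open Scope ring_scope.

(* A graph on a finite vertex type V is given by its adjacency relation
   e : rel V; loops are allowed. *)

Definition neighborhood (V : finType) (e : rel V) (V1 : {set V}) : {set V} :=
  [set v | [exists v1 in V1, e v v1]]%SET.

Definition vertex_boundary (V : finType) (e : rel V) (V1 : {set V}) : {set V} :=
  neighborhood e V1 :\: V1.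

Definition vertex_cheeger (R : realType) (V : finType) (e : rel V) : R :=
  inf [set r : R | exists V1 : {set V},
         [/\ V1 != finset.set0,
             #|V1|%:R <= #|V|%:R / 2 :> R
           & r = #|vertex_boundary e V1|%:R / #|V1|%:R]]%classic.

(* The two sides of the bipartition are A and its complement. *)
Definition bipartite (V : finType) (e : rel V) : Prop :=
  exists A : {set V}, forall x y : V, e x y -> (x \in A) != (y \in A).

Definition cayley (gT : finGroupType) (S : {set gT}) : rel gT :=
  fun x y => [exists s in S, (s * x)%g == y].

Definition symmetric_set (gT : finGroupType) (S : {set gT}) : Prop :=
  S = [set (s^-1)%g | s in S]%SET.

(* The elements of G are enumerated as enum_val i, i : 'I_#|gT|. *)
Definition normalized_adjacency (R : realType) (gT : finGroupType)
    (S : {set gT}) : 'M[R]_#|gT| :=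
  \matrix_(i, j)
    if (enum_val j * (enum_val i)^-1)%g \in S then #|S|%:R^-1 else 0.

Definition normalized_laplacian (R : realType) (gT : finGroupType)
    (S : {set gT}) : 'M[R]_#|gT| :=
  1%:M - normalized_adjacency R S.

(* The real eigenvalues of A in nondecreasing order, each repeated according
   to its algebraic multiplicity (rootsR p is the strictly increasing list of
   the real roots of p).  For a symmetric A, such as the Laplacian of a Cayley
   graph of a symmetric set, this is the whole spectrum, of length n. *)
Definition eigenvalues (R : realType) (n : nat) (A : 'M[R]_n) : seq R :=
  flatten [seq nseq (mup a (char_poly A)) a | a <- rootsR (char_poly A)].

Definition largest_eigenvalue (R : realType) (n : nat) (A : 'M[R]_n) : R :=
  last 0 (eigenvalues A).

(* Main.v *)
Require Import Defs.
From mathcomp Require Import all_boot all_order all_algebra all_fingroup.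
From mathcomp Require Import all_classical all_reals.
From mathcomp Require Import polyrcf ring lra.

(** An eigenvalue of the Laplacian close to 2 comes from a function f that
almost changes sign along every edge: if the sum of the f(x)^2 is n = |G|, then
the sum of (f(x) + f(sx))^2 over x in G and s in S is 2 d n (2 - lambda), see
[antisymmetry_energy].  The theorem is proved in contrapositive form: if
2 (2 - lambda) < c^2 with c = h^2 / (16 d^3 (d + 1)), then the Cayley graph is
bipartite ([almost_antisymmetric_bipartite]).

The edges of C(G,S) are left translations by elements of S, so they commute with
right translations.  Hence, for each t in G, the product x |-> f(x) f(xt) of f
with a right translate of itself almost does not change along edges: the two
changes of sign cancel ([product_variation]).  In a graph with positive vertex
Cheeger constant a function that varies little along edges is, in the mean of the
absolute value, close to its average ([cheeger_poincare],
[cayley_concentration]); the L^1 form of this principle follows from the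
definition of h, because both sides are additive over level sets
([total_variation_ge0]).  So f(x) f(xt) is for most x close to a number chi(t)
that depends only on t.  For t = 1 this says that f(x)^2 is mostly close to
chi(1) = 1.

Consequently chi(t) is nonzero and the sign of chi is a homomorphism from G to
{1, -1}: some x can be chosen at which f(x), f(xt), f(xtu) are all nonzero and
their pairwise products have the signs of chi(t), chi(u), chi(tu), and the product
of these three products is a square ([sign_multiplicative]).  The function f
follows this homomorphism up to a global sign, and f almost changes sign under
left multiplication by any s in S, so chi(s) < 0 ([near_antisymmetric_neg]).  The
two sides chi > 0 and chi < 0 form a bipartition of the Cayley graph.

All the choices of a good point are made by averaging one nonnegative sum of
errors; a total error below 1 is enough, which leaves room in the constants. *)
Set Implicit Arguments.
Unset Strict Implicit.
Unset Printing Implicit Defensive.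

Import Order.TTheory GRing.Theory Num.Theory.

Local Open Scope ring_scope.

(** * Total variation and the vertex Cheeger constant *)

(** A weighted total variation is a nonnegative combination of its values on the
indicators of the superlevel sets of w, so its sign can be tested on sets.  The
weights may be negative; this allows an inequality between two total variations
to be handled as the nonnegativity of a single one. *)
Lemma total_variation_ge0 (R : realFieldType) (V : finType) (a : V -> V -> R) :
    (forall A : {set V},
       0 <= \sum_x \sum_y a x y * `|(x \in A)%:R - (y \in A)%:R|) ->
  forall w : V -> R, 0 <= \sum_x \sum_y a x y * `|w x - w y|.
Proof.
move=> cut_ge0 w.
wlog w_ge0 : w / forall x, 0 <= w x.
  move=> nneg; pose w' x := w x + \sum_y `|w y|.
  have -> : \sum_x \sum_y a x y * `|w x - w y|
          = \sum_x \sum_y a x y * `|w' x - w' y|.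
    apply: eq_bigr => x _; apply: eq_bigr => y _.
    by congr (_ * `|_|); rewrite /w'; ring.
  apply: nneg => x; rewrite /w' (bigD1 x) //= addrA addr_ge0 ?sumr_ge0 //.
  by rewrite -lerBlDr sub0r lerNnormlW.
(* Induction on the size of the support: subtracting from w its least nonzero
   value on the support A peels off a multiple of the indicator of A, and the
   absolute differences split additively. *)
have [m] := ubnP #|[set x | w x != 0]|%SET.
elim: m w w_ge0 => // m IHm w w_ge0 ltm.
pose A := [set x | w x != 0]%SET.
have [A0 | [x0 Ax0]] := finset.set_0Vmem A.
  have w0 x : w x = 0.
    by have : x \notin A; [rewrite A0 inE | rewrite inE negbK => /eqP].
  rewrite big1 // => x _; rewrite big1 // => y _.
  by rewrite !w0 subrr normr0 mulr0.
case: (@Order.TotalTheory.arg_minP _ _ _ x0 (mem A) w Ax0) => x1 /= Ax1 minw.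
have {}Ax1 : x1 \in A by [].
have wA x : x \notin A -> w x = 0 by rewrite inE negbK => /eqP.
pose w' x := w x - w x1 * (x \in A)%:R.
have split_w x y : `|w x - w y|
    = `|w' x - w' y| + w x1 * `|(x \in A)%:R - (y \in A)%:R|.
  rewrite /w'; have [xA | /wA ->] := boolP (x \in A);
    have [yA | /wA ->] := boolP (y \in A).
  - by rewrite !subrr normr0 mulr0 addr0; congr `|_|; ring.
  - rewrite !mulr1 !mulr0 !subr0 normr1 mulr1 !ger0_norm ?subrK //.
    by rewrite subr_ge0 minw.
  - rewrite !mulr1 !mulr0 !subr0 !sub0r !normrN normr1 mulr1.
    by rewrite !ger0_norm ?subrK // subr_ge0 minw.
  - by rewrite !mulr0 !subrr normr0 mulr0 addr0.
have -> : \sum_x \sum_y a x y * `|w x - w y|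
    = \sum_x \sum_y a x y * `|w' x - w' y|
      + w x1 * \sum_x \sum_y a x y * `|(x \in A)%:R - (y \in A)%:R|.
  rewrite mulr_sumr -big_split; apply: eq_bigr => x _ /=.
  rewrite mulr_sumr -big_split; apply: eq_bigr => y _ /=.
  by rewrite split_w; ring.
apply: addr_ge0; last by rewrite mulr_ge0.
apply: IHm => [x|].
  rewrite /w'; have [xA | /wA ->] := boolP (x \in A).
    by rewrite mulr1 subr_ge0 minw.
  by rewrite mulr0 subr0.
rewrite ltnS in ltm; apply: leq_trans ltm.
apply: proper_card; apply/properP; split.
  apply/fintype.subsetP => x; rewrite !inE /w'; apply: contraNN => /eqP wx.
  by rewrite wx inE wx eqxx mulr0 subr0.
by exists x1; rewrite // inE /w' Ax1 mulr1 subrr eqxx.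
Qed.

Lemma vertex_cheeger_le (R : realType) (V : finType) (e : rel V) (A : {set V}) :
    A != finset.set0 -> (#|A|.*2 <= #|V|)%N ->
  vertex_cheeger R e * #|A|%:R <= #|vertex_boundary e A|%:R.
Proof.
move=> A0 leA; rewrite -ler_pdivlMr ?ltr0n ?card_gt0 //.
apply: ge_inf; last first.
  exists A; split=> //; rewrite ler_pdivlMr ?ltr0n // -natrM ler_nat.
  by rewrite muln2.
by exists 0 => r [B [_ _ ->]]; rewrite divr_ge0.
Qed.

(** For the indicator of a set, this compares |A| |V \ A| with the number of
edges leaving A: the smaller of A and its complement has at least h times its
size as vertex boundary, and each boundary vertex carries a cut edge. *)
Lemma cheeger_poincare (R : realType) (V : finType) (e : rel V) (w : V -> R) :
  vertex_cheeger R e * \sum_x \sum_y `|w x - w y|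
    <= 2 * #|V|%:R * \sum_x \sum_(y | e x y) `|w x - w y|.
Proof.
set h := vertex_cheeger R e.
pose a x y : R := 2 * #|V|%:R * (e x y)%:R - h.
have weighted (u : V -> R) : \sum_x \sum_y a x y * `|u x - u y|
    = 2 * #|V|%:R * \sum_x \sum_(y | e x y) `|u x - u y|
      - h * \sum_x \sum_y `|u x - u y|.
  rewrite !mulr_sumr -sumrB; apply: eq_bigr => x _.
  rewrite [X in _ * X - _]big_mkcond !mulr_sumr -sumrB; apply: eq_bigr => y _.
  by rewrite /a; case: (e x y) => /=; ring.
rewrite -subr_ge0 -weighted; apply: total_variation_ge0 => A.
rewrite {}weighted subr_ge0.
have boundary_le (B : {set V}) :
    #|vertex_boundary e B|%:R
      <= \sum_x \sum_(y | e x y) `|(x \in B)%:R - (y \in B)%:R| :> R.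
  rewrite -sum1_card natr_sum big_mkcond; apply: ler_sum => x _.
  case: ifP => [|_]; last by rewrite sumr_ge0.
  rewrite !inE => /andP[/negPf xB /existsP[y /andP[yB exy]]].
  by rewrite (bigD1 y) //= xB yB sub0r normrN normr1 lerDl sumr_ge0.
have cutE : \sum_x \sum_y `|(x \in A)%:R - (y \in A)%:R|
    = 2 * #|A|%:R * #|~: A|%:R :> R.
  have oneA (B : {set V}) : #|B|%:R = \sum_x (x \in B)%:R :> R.
    rewrite -sum1_card natr_sum big_mkcond; apply: eq_bigr => x _.
    by case: (x \in B).
  transitivity (\sum_x \sum_y ((x \in A)%:R * (y \in ~: A)%:R
                 + (x \in ~: A)%:R * (y \in A)%:R) : R).
    apply: eq_bigr => x _; apply: eq_bigr => y _; rewrite !inE.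
    by case: (x \in A); case: (y \in A);
      rewrite /= ?subrr ?subr0 ?sub0r ?normrN ?normr1 ?normr0
        ?mul0r ?mulr0 ?mul1r ?addr0 ?add0r.
  under eq_bigr do rewrite big_split -!mulr_sumr -!oneA /=.
  by rewrite big_split -!mulr_suml -!oneA /=; ring.
have complE : \sum_x \sum_(y | e x y) `|(x \in ~: A)%:R - (y \in ~: A)%:R|
    = \sum_x \sum_(y | e x y) `|(x \in A)%:R - (y \in A)%:R| :> R.
  apply: eq_bigr => x _; apply: eq_bigr => y _; rewrite !inE.
  by case: (x \in A); case: (y \in A); rewrite /= ?subrr ?subr0 ?sub0r ?normrN.
rewrite cutE; set E := (X in _ <= _ * X).
have half (B C : {set V}) : (#|B| + #|C| = #|V|)%N -> (#|B|.*2 <= #|V|)%N ->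
    #|vertex_boundary e B|%:R <= E ->
    h * (2 * #|B|%:R * #|C|%:R) <= 2 * #|V|%:R * E.
  move=> BC leB bE.
  have E0 : 0 <= E by apply: le_trans bE.
  have leCV : #|C|%:R <= #|V|%:R :> R by rewrite ler_nat -BC leq_addl.
  have [->|B0] := eqVneq B finset.set0.
    by rewrite cards0 mulr0 mul0r mulr0 !mulr_ge0.
  have hB : h * #|B|%:R <= E by apply: le_trans bE; apply: vertex_cheeger_le.
  have -> : h * (2 * #|B|%:R * #|C|%:R) = 2 * #|C|%:R * (h * #|B|%:R) by ring.
  apply: le_trans (_ : 2 * #|C|%:R * E <= _); first by rewrite ler_wpM2l ?mulr_ge0.
  by rewrite ler_wpM2r // ler_wpM2l.
have cA := cardsC A.
have [leA|ltA] := leqP #|A|.*2 #|V|; first exact: half cA leA (boundary_le A).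
rewrite mulrAC; apply: half; first by rewrite addnC.
  by rewrite -cA -addnn leq_add2r; rewrite -cA -addnn ltn_add2l in ltA; apply: ltnW.
by rewrite /E -complE boundary_le.
Qed.

Lemma cayley_sum (R : nmodType) (gT : finGroupType) (S : {set gT}) (x : gT)
    (F : gT -> R) :
  \sum_(y | cayley S x y) F y = \sum_(s in S) F (s * x)%g.
Proof.
rewrite (reindex_inj (mulIg x)) /=; apply: eq_bigl => s.
apply/existsP/idP => [[t /andP[tS /eqP/mulIg <-]] //|sS].
by exists s; rewrite sS /=.
Qed.

Definition mean (R : realFieldType) (V : finType) (w : V -> R) : R :=
  (\sum_x w x) / #|V|%:R.

(** The absolute deviation from the mean at x is at most the average of
|w x - w y| over y, to which the Poincare inequality applies. *)
Lemma cayley_concentration (R : realType) (gT : finGroupType) (S : {set gT})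
    (w : gT -> R) :
  vertex_cheeger R (cayley S) * \sum_x `|w x - mean w|
    <= 2 * \sum_x \sum_(s in S) `|w x - w (s * x)%g|.
Proof.
set h := vertex_cheeger _ _.
have n_gt0 : 0 < #|gT|%:R :> R by rewrite ltr0n; apply/card_gt0P; exists 1%g.
(* Without any admissible set, the infimum is that of the empty set, namely 0. *)
have h_ge0 : 0 <= h.
  have [/set0P nonempty|] := boolP ([set r : R | exists V1 : {set gT},
     [/\ V1 != finset.set0, #|V1|%:R <= #|gT|%:R / 2 :> R
       & r = #|vertex_boundary (cayley S) V1|%:R / #|V1|%:R]]%classic != classical_sets.set0).
    by apply: lb_le_inf => // r [B [_ _ ->]]; rewrite divr_ge0.
  by rewrite negbK => /eqP e; rewrite /h /vertex_cheeger e inf0.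
have dev : #|gT|%:R * \sum_x `|w x - mean w| <= \sum_x \sum_y `|w x - w y|.
  rewrite mulr_sumr; apply: ler_sum => x _.
  rewrite -[X in X * _]gtr0_norm // -normrM.
  have -> : #|gT|%:R * (w x - mean w) = \sum_y (w x - w y).
    rewrite sumrB sumr_const -[w x *+ _]mulr_natl mulrBr; congr (_ - _).
    by rewrite /mean mulrC divfK // gt_eqF.
  exact: ler_norm_sum.
rewrite -(ler_pM2l n_gt0) mulrCA.
apply: le_trans (ler_wpM2l h_ge0 dev) _.
apply: le_trans (cheeger_poincare (cayley S) w) _.
rewrite mulrA [_ * 2]mulrC le_eqVlt; apply/orP; left; apply/eqP.
by congr (_ * _); apply: eq_bigr => x _; rewrite cayley_sum.
Qed.

Lemma cheeger_le_degree (R : realType) (gT : finGroupType) (S : {set gT}) :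
  (2 <= #|gT|)%N -> vertex_cheeger R (cayley S) <= #|S|%:R.
Proof.
move=> n2; have := @vertex_cheeger_le R _ (cayley S) [set 1%g].
rewrite cards1 mulr1 => /(_ _ n2) h_le; apply: le_trans (h_le _) _.
  by apply/set0Pn; exists 1%g; rewrite inE.
rewrite ler_nat -(card_imset (mem S) invg_inj); apply/subset_leq_card.
apply/fintype.subsetP => x; rewrite !inE => /andP[_ /existsP[y /andP[]]].
rewrite inE => /eqP -> /existsP[s /andP[sS /eqP sx1]].
by apply/imsetP; exists s; rewrite // -[RHS]mulg1 -sx1 mulKg.
Qed.

(** * Functions whose translates have nearly constant products *)

Lemma exists_lt1_of_sum_lt (R : realFieldType) (T : finType) (F : T -> R) :
  \sum_x F x < #|T|%:R -> exists x, F x < 1.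
Proof.
move=> ltF; apply/existsP; apply: contraLR ltF => /existsPn F_ge1.
rewrite -leNgt -sumr_const; apply: ler_sum => x _.
by rewrite leNgt F_ge1.
Qed.

(** Write a, b, e for the three errors.  The hypothesis gives
(p q)^2 >= (1 - a) (1 - b) >= 1 - a - b > e >= e^2, so c is closer to p q
than p q is to 0. *)
Lemma sign_of_product (R : realFieldType) (p q c : R) :
  `|p ^+ 2 - 1| + `|q ^+ 2 - 1| + `|p * q - c| < 1 -> 0 < p * q * c.
Proof.
set a := `|_ - 1|; set b := `|_ - 1|; set e := `|_ - c| => lt1.
have [a0 b0 e0] : [/\ 0 <= a, 0 <= b & 0 <= e] by split; apply: normr_ge0.
have pa : 1 - a <= p ^+ 2.
  by rewrite lerBlDr -lerBlDl; apply: le_trans (ler_norm _) _; rewrite distrC.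
have qb : 1 - b <= q ^+ 2.
  by rewrite lerBlDr -lerBlDl; apply: le_trans (ler_norm _) _; rewrite distrC.
have e2 : (p * q - c) ^+ 2 = e ^+ 2 by rewrite real_normK ?num_real.
have pq2 : (1 - a) * (1 - b) <= (p * q) ^+ 2.
  by rewrite exprMn ler_pM // subr_ge0; lra.
have c2 : 0 <= c ^+ 2 by rewrite sqr_ge0.
nra.
Qed.

Lemma gt0_of_sqr_mul (R : realDomainType) (k z : R) : 0 < k ^+ 2 * z -> 0 < z.
Proof.
by apply: contraTT; rewrite -!leNgt => z0; rewrite mulr_ge0_le0 ?sqr_ge0.
Qed.

(** At a point x where the six errors listed in the proof add up to less than 1,
chi t, chi u and chi (t * u) have the signs of p q, q r and p r, where p, q, r are
the values of f at x, xt, xtu; and (p q) (q r) (p r) is a square. *)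
Lemma sign_multiplicative (R : realFieldType) (gT : finGroupType)
    (f chi : gT -> R) :
    chi 1%g = 1 ->
    (forall t, \sum_x `|f x * f (x * t)%g - chi t| <= #|gT|%:R / 8) ->
  forall t u, 0 < chi t * chi u * chi (t * u)%g.
Proof.
move=> chi1 near t u.
have n_gt0 : 0 < #|gT|%:R :> R by rewrite ltr0n; apply/card_gt0P; exists 1%g.
have shift a (F : gT -> R) : \sum_x F (x * a)%g = \sum_x F x.
  by rewrite [RHS](reindex_inj (mulIg a)).
pose dev x := `|f x ^+ 2 - 1|.
have sum_dev : \sum_x dev x <= #|gT|%:R / 8.
  have:= near 1%g; rewrite chi1; congr (_ <= _).
  by apply: eq_bigr => x _; rewrite mulg1 -expr2.
have [|x] := @exists_lt1_of_sum_lt R gT (fun x =>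
    dev x + dev (x * t)%g + dev (x * (t * u))%g
    + `|f x * f (x * t)%g - chi t|
    + `|f (x * t)%g * f (x * t * u)%g - chi u|
    + `|f x * f (x * (t * u))%g - chi (t * u)%g|).
  rewrite !big_split /= (shift t dev) (shift (t * u)%g dev).
  rewrite (shift t (fun y => `|f y * f (y * u)%g - chi u|)).
  have := near t; have := near u; have := near (t * u)%g.
  by lra.
rewrite /dev mulgA; set p := f x; set q := f (x * t)%g.
set r := f (x * t * u)%g => lt1.
have dev_ge0 y : 0 <= `|y : R| by apply: normr_ge0.
have pq : 0 < p * q * chi t.
  apply: sign_of_product.
  have := (dev_ge0 (r ^+ 2 - 1), dev_ge0 (q * r - chi u),
    dev_ge0 (p * r - chi (t * u)%g)).
  by case=> [[]]; lra.
have qr : 0 < q * r * chi u.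
  apply: sign_of_product.
  have := (dev_ge0 (p ^+ 2 - 1), dev_ge0 (p * q - chi t),
    dev_ge0 (p * r - chi (t * u)%g)).
  by case=> [[]]; lra.
have pr : 0 < p * r * chi (t * u)%g.
  apply: sign_of_product.
  have := (dev_ge0 (q ^+ 2 - 1), dev_ge0 (p * q - chi t),
    dev_ge0 (q * r - chi u)).
  by case=> [[]]; lra.
have : 0 < (p * q * r) ^+ 2 * (chi t * chi u * chi (t * u)%g).
  have -> : (p * q * r) ^+ 2 * (chi t * chi u * chi (t * u)%g)
    = (p * q * chi t) * (q * r * chi u) * (p * r * chi (t * u)%g) by ring.
  exact: mulr_gt0 (mulr_gt0 pq qr) pr.
exact: gt0_of_sqr_mul.
Qed.

(** For most pairs (x, y), f y has the sign of f x times chi (x^-1 y), and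
f (s y) that of f x times chi (x^-1 s y).  By multiplicativity of the signs,
f y and f (s y) differ by the sign of chi s; but f y + f (s y) is mostly small
while f y and f (s y) are mostly of absolute value about 1, so their signs are
opposite.  Left multiplication of y by s is right multiplication of x by a
conjugate of s that depends on y; this is why the argument averages over pairs
and not over a single translation. *)
Lemma near_antisymmetric_neg (R : realFieldType) (gT : finGroupType)
    (f chi : gT -> R) (s : gT) :
    chi 1%g = 1 ->
    (forall t, \sum_x `|f x * f (x * t)%g - chi t| <= #|gT|%:R / 8) ->
    \sum_x (f x + f (s * x)%g) ^+ 2 <= #|gT|%:R / 8 ->
  chi s < 0.
Proof.
move=> chi1 near anti.
have n_gt0 : 0 < #|gT|%:R :> R by rewrite ltr0n; apply/card_gt0P; exists 1%g.
have chi_mul := sign_multiplicative chi1 near.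
pose dev x := `|f x ^+ 2 - 1|.
have sum_dev : \sum_x dev x <= #|gT|%:R / 8.
  have:= near 1%g; rewrite chi1; congr (_ <= _).
  by apply: eq_bigr => x _; rewrite mulg1 -expr2.
have sum_pair : \sum_x \sum_y `|f x * f y - chi (x^-1 * y)%g|
    <= #|gT|%:R * (#|gT|%:R / 8).
  have -> : \sum_x \sum_y `|f x * f y - chi (x^-1 * y)%g|
          = \sum_t \sum_x `|f x * f (x * t)%g - chi t|.
    rewrite [RHS]exchange_big; apply: eq_bigr => x _ /=.
    rewrite (reindex_inj (mulgI x)); apply: eq_bigr => t _ /=.
    by rewrite mulKg.
  rewrite [X in _ <= X]mulr_natl -sumr_const.
  by apply: ler_sum => t _; apply: near.
have [|x] := @exists_lt1_of_sum_lt R gT (fun x => (\sum_y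
    (dev x + dev y + dev (s * y)%g + `|f x * f y - chi (x^-1 * y)%g|
    + `|f x * f (s * y)%g - chi (x^-1 * (s * y))%g|
    + (f y + f (s * y)%g) ^+ 2)) / #|gT|%:R).
  rewrite -mulr_suml ltr_pdivrMr //.
  have shift (F : gT -> R) : \sum_y F (s * y)%g = \sum_y F y.
    by rewrite [RHS](reindex_inj (mulgI s)).
  have cst a : \sum_(x in gT) a = #|gT|%:R * a :> R.
    by rewrite sumr_const mulr_natl.
  under eq_bigr => x _.
    rewrite !big_split /= cst (shift dev).
    rewrite (shift (fun y => `|f x * f y - chi (x^-1 * y)%g|)).
    over.
  rewrite /= !big_split /= -mulr_sumr !cst.
  have : #|gT|%:R * \sum_y dev y <= #|gT|%:R * (#|gT|%:R / 8).
    by rewrite ler_wpM2l.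
  have : #|gT|%:R * \sum_y (f y + f (s * y)%g) ^+ 2 <= #|gT|%:R * (#|gT|%:R / 8).
    by rewrite ler_wpM2l.
  have : 0 < #|gT|%:R * #|gT|%:R :> R by rewrite mulr_gt0.
  by lra.
rewrite ltr_pdivrMr // mul1r => /exists_lt1_of_sum_lt[y].
rewrite /dev; set p := f x; set q := f y; set r := f (s * y)%g.
set a := chi (x^-1 * y)%g; set b := chi (x^-1 * (s * y))%g => lt1.
have abs_ge0 z : 0 <= `|z : R| by apply: normr_ge0.
have qr_sq : 0 <= (q + r) ^+ 2 by rewrite sqr_ge0.
have pqa : 0 < p * q * a.
  apply: sign_of_product.
  have := (abs_ge0 (r ^+ 2 - 1), abs_ge0 (p * r - b)).
  by case; lra.
have prb : 0 < p * r * b.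
  apply: sign_of_product.
  have := (abs_ge0 (q ^+ 2 - 1), abs_ge0 (p * q - a)).
  by case; lra.
have qr_lt0 : q * r < 0.
  have q2 : 1 - q ^+ 2 <= `|q ^+ 2 - 1| by rewrite distrC ler_norm.
  have r2 : 1 - r ^+ 2 <= `|r ^+ 2 - 1| by rewrite distrC ler_norm.
  have := (abs_ge0 (p ^+ 2 - 1), abs_ge0 (p * q - a), abs_ge0 (p * r - b)).
  by case=> [[]]; move: q2 r2 lt1; rewrite sqrrD; lra.
have xy := chi_mul x^-1%g y; have xsy := chi_mul x^-1%g (s * y)%g.
have sy := chi_mul s y; rewrite -/a -/b in xy xsy.
have : 0 < (p * a * b * chi x^-1%g * chi y * chi (s * y)%g) ^+ 2
    * (q * r * chi s).
  have -> : (p * a * b * chi x^-1%g * chi y * chi (s * y)%g) ^+ 2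
      * (q * r * chi s)
    = (p * q * a) * (p * r * b) * (chi x^-1%g * chi y * a)
      * (chi x^-1%g * chi (s * y)%g * b) * (chi s * chi y * chi (s * y)%g).
    by ring.
  exact: mulr_gt0 (mulr_gt0 (mulr_gt0 (mulr_gt0 pqa prb) xy) xsy) sy.
by move/gt0_of_sqr_mul; rewrite nmulr_rgt0.
Qed.

(** * Nearly antisymmetric functions and bipartiteness *)

(** Along an edge, the difference of the products is
f x (f (xt) + f (sxt)) - f (sxt) (f x + f (sx)), a sum of two terms each with
a small factor.  The parameter c balances the two sides of the inequality
2 c |a b| <= c^2 a^2 + b^2, which replaces Cauchy-Schwarz. *)
Lemma product_variation (R : realFieldType) (gT : finGroupType) (S : {set gT})
    (f : gT -> R) (c : R) (t : gT) :
    0 < c -> \sum_x f x ^+ 2 = #|gT|%:R ->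
    \sum_x \sum_(s in S) (f x + f (s * x)%g) ^+ 2
      <= #|S|%:R * c ^+ 2 * #|gT|%:R ->
  \sum_x \sum_(s in S) `|f x * f (x * t)%g - f (s * x)%g * f (s * x * t)%g|
    <= 2 * c * #|S|%:R * #|gT|%:R.
Proof.
move=> c_gt0 norm_f anti.
have tr (F : gT -> R) : \sum_x F (x * t)%g = \sum_x F x.
  by rewrite [RHS](reindex_inj (mulIg t)).
have tl s (F : gT -> R) : \sum_x F (s * x)%g = \sum_x F x.
  by rewrite [RHS](reindex_inj (mulgI s)).
have amgm p q r u : 2 * c * `|p * q - r * u|
    <= (c ^+ 2 * p ^+ 2 + (q + u) ^+ 2) + (c ^+ 2 * u ^+ 2 + (p + r) ^+ 2).
  rewrite -[2 * c]gtr0_norm ?mulr_gt0 // -normrM ler_norml.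
  have h1 := sqr_ge0 (c * p - (q + u)); have h2 := sqr_ge0 (c * u + (p + r)).
  have h3 := sqr_ge0 (c * p + (q + u)); have h4 := sqr_ge0 (c * u - (p + r)).
  by apply/andP; split; nra.
have c2_gt0 : 0 < 2 * c by rewrite mulr_gt0.
rewrite -(ler_pM2l c2_gt0) mulr_sumr.
under eq_bigr do rewrite mulr_sumr.
apply: le_trans (_ : \sum_x \sum_(s in S)
  ((c ^+ 2 * f x ^+ 2 + (f (x * t)%g + f (s * x * t)%g) ^+ 2)
   + (c ^+ 2 * f (s * x * t)%g ^+ 2 + (f x + f (s * x)%g) ^+ 2)) <= _).
  by apply: ler_sum => x _; apply: ler_sum => s _; apply: amgm.
under eq_bigr do rewrite !big_split /= sumr_const -mulrnAr -!mulr_sumr.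
rewrite !big_split /= -!mulr_sumr sumrMnl norm_f.
have -> : \sum_x \sum_(s in S) (f (x * t)%g + f (s * x * t)%g) ^+ 2
        = \sum_x \sum_(s in S) (f x + f (s * x)%g) ^+ 2.
  rewrite -(tr (fun x => \sum_(s in S) (f x + f (s * x)%g) ^+ 2)).
  by apply: eq_bigr => x _; apply: eq_bigr => s _; rewrite mulgA.
have -> : \sum_x \sum_(s in S) f (s * x * t)%g ^+ 2 = #|gT|%:R *+ #|S|.
  rewrite exchange_big -sumr_const; apply: eq_bigr => s _ /=.
  by rewrite (tl s (fun x => f (x * t)%g ^+ 2)) (tr (fun x => f x ^+ 2)).
rewrite -(mulr_natl #|gT|%:R).
apply: le_trans (lerD (lerD (lexx _) anti) (lerD (lexx _) anti)) _.
by rewrite le_eqVlt; apply/orP; left; apply/eqP; ring.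
Qed.

(** The constant c is such that c d <= h / 32 and c d <= 1 / 32, both because
h <= d; the first makes the products f x f (xt) concentrated up to n / 8, the
second bounds d c^2 by 1 / 8. *)
Lemma almost_antisymmetric_bipartite (R : realType) (gT : finGroupType)
    (S : {set gT}) (f : gT -> R) (h := vertex_cheeger R (cayley S))
    (c := h ^+ 2 / (16 * #|S|%:R ^+ 3 * (#|S|%:R + 1))) :
    (2 <= #|gT|)%N -> 0 < h -> \sum_x f x ^+ 2 = #|gT|%:R ->
    \sum_x \sum_(s in S) (f x + f (s * x)%g) ^+ 2
      <= #|S|%:R * c ^+ 2 * #|gT|%:R ->
  bipartite (cayley S).
Proof.
move=> n2 h_gt0 norm_f anti.
have h_le_d : h <= #|S|%:R by apply: cheeger_le_degree.
have n_gt0 : 0 < #|gT|%:R :> R by rewrite ltr0n; apply: leq_trans n2.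
have d_ge1 : 1 <= #|S|%:R :> R.
  by rewrite ler1n -(ltr0n R); apply: lt_le_trans h_le_d.
set d : R := #|S|%:R in h_le_d d_ge1 c anti *.
set n : R := #|gT|%:R in n_gt0 norm_f anti *.
have d_gt0 : 0 < d by lra.
have d1_gt0 : 0 < d + 1 by lra.
have c_gt0 : 0 < c by rewrite divr_gt0 ?mulr_gt0 ?exprn_gt0.
have c_eq : c * (16 * d ^+ 3 * (d + 1)) = h ^+ 2.
  by rewrite divfK // gt_eqF // !mulr_gt0 ?exprn_gt0.
have cdh : 32 * (c * d) <= h.
  have : (16 * (d ^+ 2 * (d + 1))) * (c * d) <= d * h.
    have -> : (16 * (d ^+ 2 * (d + 1))) * (c * d) = h ^+ 2 by rewrite -c_eq; ring.
    by rewrite expr2 ler_wpM2r // ltW.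
  have dd : d * 2 <= d ^+ 2 * (d + 1) by nra.
  have cd0 : 0 < c * d by rewrite mulr_gt0.
  move=> le; rewrite -(ler_pM2l d_gt0); apply: le_trans le.
  by nra.
have cd1 : c * d <= 32^-1.
  have d2_gt0 : 0 < d ^+ 2 by rewrite exprn_gt0.
  have : d ^+ 2 * (16 * (d + 1) * (c * d)) <= d ^+ 2 * 1.
    have -> : d ^+ 2 * (16 * (d + 1) * (c * d)) = h ^+ 2 by rewrite -c_eq; ring.
    by rewrite mulr1 lerXn2r ?nnegrE // ltW.
  rewrite ler_pM2l // => le1.
  have : 2 * (c * d) <= (d + 1) * (c * d).
    by apply: ler_wpM2r; [rewrite ltW // mulr_gt0 | lra].
  by lra.
pose chi t : R := mean (fun x => f x * f (x * t)%g).
have chi1 : chi 1%g = 1.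
  rewrite /chi /mean; under eq_bigr do rewrite mulg1 -expr2.
  by rewrite norm_f divff // gt_eqF.
have near t : \sum_x `|f x * f (x * t)%g - chi t| <= n / 8.
  rewrite -(ler_pM2l h_gt0).
  apply: le_trans (cayley_concentration S (fun x => f x * f (x * t)%g)) _ => /=.
  have le_hn : 32 * (c * d) * n <= h * n by rewrite ler_wpM2r // ltW.
  apply: le_trans (ler_wpM2l _ (product_variation t c_gt0 norm_f anti)) _ => //.
  have -> : 2 * (2 * c * d * n) = 32 * (c * d) * n / 8 by field.
  by rewrite [X in _ <= X]mulrA ler_pM2r // invr_gt0.
have anti1 s : s \in S -> \sum_x (f x + f (s * x)%g) ^+ 2 <= n / 8.
  move=> sS; apply: le_trans (_ : d * c ^+ 2 * n <= _).
    apply: le_trans anti; apply: ler_sum => x _.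
    by rewrite (bigD1 s) //= lerDl sumr_ge0 // => u _; rewrite sqr_ge0.
  rewrite mulrC ler_pM2l // expr2.
  have c_le_cd : c <= c * d by rewrite ler_peMr // ltW.
  have -> : d * (c * c) = c * d * c by ring.
  have c1 : c <= 32^-1 by lra.
  have : c * d * c <= 32^-1 * 32^-1.
    by apply: ler_pM => //; rewrite ltW // mulr_gt0.
  by lra.
have chi_neg s : s \in S -> chi s < 0.
  by move=> sS; apply: near_antisymmetric_neg chi1 near (anti1 s sS).
exists [set x | 0 < chi x]%SET => x y /existsP[s /andP[sS /eqP <-]].
have := sign_multiplicative chi1 near s x; rewrite -mulrA.
rewrite nmulr_rgt0 ?chi_neg // !inE => sgn.
case: (ltrgtP 0 (chi x)) sgn => [cx|cx|<-].
- by rewrite pmulr_rlt0 // => /ltW; rewrite leNgt => /negPf ->.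
- by rewrite nmulr_rlt0 // => ->.
- by rewrite mul0r ltxx.
Qed.

(** * The top of the spectrum *)

(** The first alternative is the default value, for a matrix without real
eigenvalues. *)
Lemma largest_eigenvalueP (R : realType) (n : nat) (A : 'M[R]_n) :
  largest_eigenvalue A = 0 \/ eigenvalue A (largest_eigenvalue A).
Proof.
rewrite /largest_eigenvalue.
have [->|[a [s def_s]]] : eigenvalues A = [::]
    \/ exists a s, eigenvalues A = a :: s.
- by case: (eigenvalues A) => [|a s]; [left | right; exists a, s].
- by left.
right; have : last 0 (eigenvalues A) \in eigenvalues A by rewrite def_s /= mem_last.
case/flatten_mapP => b b_root /nseqP[-> _].
move: b_root; rewrite -roots_on_rootsR ?monic_neq0 ?char_poly_monic //.
by rewrite eigenvalue_root_char => /andP[].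
Qed.

(** A row eigenvector of the Laplacian is read as a function on G; the symmetry of
S turns the sum over the neighbours s^-1 x into the sum over the sx. *)
Lemma laplacian_eigenfunction (R : realType) (gT : finGroupType)
    (S : {set gT}) (lam : R) :
    symmetric_set S -> S != finset.set0 ->
    eigenvalue (normalized_laplacian R S) lam ->
  exists2 f : gT -> R, exists x, f x != 0 &
    forall x, \sum_(s in S) f (s * x)%g = #|S|%:R * (1 - lam) * f x.
Proof.
move=> symS S0 /eigenvalueP[v eq_v v0].
have d_gt0 : 0 < #|S|%:R :> R by rewrite ltr0n card_gt0.
have invS s : (s^-1 \in S)%g = (s \in S).
  have inv t : t \in S -> (t^-1)%g \in S.
    by move=> tS; rewrite symS; apply: imset_f.
  by apply/idP/idP => [/inv|/inv //]; rewrite invgK.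
exists (fun x => v 0 (enum_rank x)).
  have /rV0Pn[i vi] := v0.
  by exists (enum_val i); rewrite enum_valK.
move=> y; have := congr1 (fun u : 'rV_#|gT| => u 0 (enum_rank y)) eq_v.
rewrite /normalized_laplacian mulmxBr mulmx1 !mxE => eq_y.
rewrite -mulrA mulrBl mul1r -eq_y opprB addrC subrK.
rewrite (reindex _ (onW_bij _ (@enum_rank_bij gT))) /=.
rewrite mulr_sumr -(cayley_sum S y (fun x => v 0 (enum_rank x))) big_mkcond /=.
apply: eq_bigr => x _; rewrite !mxE !enum_rankK.
have -> : cayley S y x = ((y * x^-1)%g \in S).
  rewrite -invS invMg invgK.
  apply/existsP/idP => [[s /andP[sS /eqP <-]]|]; first by rewrite mulgK.
  by exists (x * y^-1)%g; rewrite mulgKV eqxx andbT.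
by case: ifP => _; rewrite ?mulr0 // mulrCA divff ?mulr1 // gt_eqF.
Qed.

Lemma antisymmetry_energy (R : realFieldType) (gT : finGroupType)
    (S : {set gT}) (f : gT -> R) (lam : R) :
    (forall x, \sum_(s in S) f (s * x)%g = #|S|%:R * (1 - lam) * f x) ->
  \sum_x \sum_(s in S) (f x + f (s * x)%g) ^+ 2
    = #|S|%:R * (2 * (2 - lam)) * \sum_x f x ^+ 2.
Proof.
move=> eigen_f.
have tl : \sum_x \sum_(s in S) f (s * x)%g ^+ 2 = #|S|%:R * \sum_x f x ^+ 2.
  rewrite exchange_big mulr_natl -sumr_const; apply: eq_bigr => s _ /=.
  by rewrite [RHS](reindex_inj (mulgI s)).
have -> : \sum_x \sum_(s in S) (f x + f (s * x)%g) ^+ 2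
    = \sum_x (#|S|%:R + 2 * (#|S|%:R * (1 - lam))) * f x ^+ 2
      + \sum_x \sum_(s in S) f (s * x)%g ^+ 2.
  rewrite -big_split; apply: eq_bigr => x _ /=.
  under eq_bigr do rewrite sqrrD -mulrnAl.
  rewrite !big_split /= sumr_const -mulr_sumr eigen_f -[_ ^+ 2 *+ _]mulr_natl.
  by congr (_ + _); ring.
by rewrite tl -mulr_sumr; ring.
Qed.

Theorem theorem1p4 (R : realType) (gT : finGroupType) (S : {set gT})
    (hn : (2 <= #|gT|)%N)
    (hsym : symmetric_set S)
    (hgen : <<S>>%g = [set: gT]%SET)
    (hd : (1 <= #|S|)%N)
    (hexp : 0 < vertex_cheeger R (cayley S))
    (hnonbip : ~ bipartite (cayley S)) :
  largest_eigenvalue (normalized_laplacian R S) <=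
    2 - vertex_cheeger R (cayley S) ^+ 4
        / (2 ^+ 9 * #|S|%:R ^+ 6 * (#|S|%:R + 1) ^+ 2).
Proof.
set lam := largest_eigenvalue _.
have h_le_d := @cheeger_le_degree R _ S hn.
have d_ge1 : 1 <= #|S|%:R :> R by rewrite ler1n.
set h := vertex_cheeger R (cayley S) in hexp h_le_d *.
pose c : R := h ^+ 2 / (16 * #|S|%:R ^+ 3 * (#|S|%:R + 1)).
have -> : h ^+ 4 / (2 ^+ 9 * #|S|%:R ^+ 6 * (#|S|%:R + 1) ^+ 2) = c ^+ 2 / 2.
  by rewrite /c; field; rewrite !gt_eqF //; lra.
have [lam0|] := largest_eigenvalueP (normalized_laplacian R S).
  rewrite /lam lam0 subr_ge0.
  have c_ge0 : 0 <= c by rewrite divr_ge0 ?mulr_ge0 ?sqr_ge0 ?exprn_ge0 //; lra.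
  have : c <= 1.
    rewrite ler_pdivrMr ?mul1r; last by rewrite !mulr_gt0 ?exprn_gt0 //; lra.
    have : h ^+ 2 <= #|S|%:R ^+ 2 by rewrite lerXn2r ?nnegrE //; lra.
    have : 1 * #|S|%:R ^+ 2 <= #|S|%:R * #|S|%:R ^+ 2 :> R.
      by rewrite ler_wpM2r ?sqr_ge0.
    rewrite -exprS mul1r; nra.
  by nra.
rewrite -/lam => /(laplacian_eigenfunction hsym).
case=> [|f [x0 fx0] eigen_f]; first by rewrite -card_gt0.
rewrite leNgt; apply/negP => lam_gt; apply: hnonbip.
have N_gt0 : 0 < \sum_x f x ^+ 2.
  rewrite (bigD1 x0) //= ltr_wpDr ?exprn_even_gt0 //.
  by rewrite sumr_ge0 // => x _; rewrite sqr_ge0.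
have n_gt0 : 0 < #|gT|%:R :> R by rewrite ltr0n; apply: leq_trans hn.
(* Rescaling f so that the mean of its square is 1. *)
pose k := Num.sqrt (#|gT|%:R / \sum_x f x ^+ 2).
have norm_kf : \sum_x (k * f x) ^+ 2 = #|gT|%:R.
  under eq_bigr do rewrite exprMn.
  by rewrite -mulr_sumr sqr_sqrtr ?divfK ?gt_eqF // divr_ge0 ?ltW.
apply: (almost_antisymmetric_bipartite hn hexp norm_kf).
rewrite (antisymmetry_energy (lam := lam)).
  rewrite norm_kf ler_pM2r // ler_pM2l; last by lra.
  by rewrite -/h -/c; lra.
by move=> x; rewrite -mulr_sumr eigen_f mulrCA.
Qed.
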